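(* For every positive integer $k$ and all integers $m$ and $n$ the following identities hold: \[ \sum_{j = 0}^k \sum_{i = 0}^j ( - 1)^i \binom kj\binom ji (tu_{m - 1} )^{k - j}u_m^{k + j - i} w_{n - k + 2j + (m - 1)i} = (u_{m + 1} - ru_m )^k ( - u_m )^k w_n, \] \[ \sum_{j = 0}^k \sum_{i = 0}^j ( - 1)^i \binom kj\binom ji u_m^{k - j} (tu_{m - 1} )^{k + j - i} w_{n + k - 2j + (m + 1)i} = (u_{m + 1} - ru_m )^k ( - tu_{m - 1} )^k w_n, \] \[ \sum_{j = 0}^k \sum_{i = 0}^j ( - 1)^j \binom kj\binom ji (tu_{m - 1} )^{k + j - i} u_m^i w_{n + mk - (m + 1)j + 2i} = (u_{m + 1} - ru_m )^k (tu_{m - 1} )^k w_n, \] \[ \sum_{j = 0}^k \sum_{i = 0}^j \binom kj\binom ji (tu_{m - 1} )^{k - j} u_m^{j - i} (u_{m + 1} - ru_m )^i w_{n - (m + 1)k + 2j - i} = w_n, \] \[ \sum_{j = 0}^k \sum_{i = 0}^j ( - 1)^{i + j} \binom kj\binom ji (tu_{m - 1} )^{k - j} (u_{m + 1} - ru_m )^i w_{n - 2k + (m + 1)j - mi} = ( - 1)^k u_m^k w_n, \] \[ \sum_{j = 0}^k \sum_{i = 0}^j ( - 1)^{i + j} \binom kj\binom ji u_m^{k - j} (u_{m + 1} - ru_m )^i w_{n + 2k + (m - 1)j - mi} = ( - 1)^k (tu_{m - 1} )^k w_n. \]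
   Context: Let $a,b,c,r,s,t$ be complex numbers with $t\neq 0$. The sequence $(w_n)=(w_n(a,b,c;r,s,t))$ is defined by $w_0=a$, $w_1=b$, $w_2=c$ and $w_n=rw_{n-1}+sw_{n-2}+tw_{n-3}$ for $n\ge 3$, and is extended to negative indices by $w_{-n}=(w_{-(n-3)}-rw_{-(n-2)}-sw_{-(n-1)})/t$, so that the recurrence holds for all integer indices. Put $u_n=w_n(0,1,r;r,s,t)$ for all integers $n$. The convention $0^0=1$ is used. *)

(* Defs.v *)
From HB Require Import structures.
From mathcomp Require Import all_boot all_order all_algebra.

Set Implicit Arguments.
Unset Strict Implicit.
Unset Printing Implicit Defensive.

Import Order.TTheory GRing.Theory Num.Theory.
Local Open Scope ring_scope.

Fixpoint trib_up (F : fieldType) (a b c r s t : F) (n : nat) : F :=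
  match n with
  | 0 => a
  | 1 => b
  | 2 => c
  | (((n0.+1) as n1).+1 as n2).+1 =>
      r * trib_up a b c r s t n2 + s * trib_up a b c r s t n1
      + t * trib_up a b c r s t n0
  end.

(* [trib_down a b c r s t n] is the term of index [2 - n]: starting the downward
   recursion at index 2 makes its three initial values the given c, b, a. *)
Fixpoint trib_down (F : fieldType) (a b c r s t : F) (n : nat) : F :=
  match n with
  | 0 => c
  | 1 => b
  | 2 => a
  | (((n0.+1) as n1).+1 as n2).+1 =>
      (trib_down a b c r s t n0 - r * trib_down a b c r s t n1
       - s * trib_down a b c r s t n2) / t
  end.

(* [Negz n] is the integer - (n + 1) = 2 - (n + 3). *)
Definition trib_w (F : fieldType) (a b c r s t : F) (n : int) : F :=
  match n with
  | Posz n => trib_up a b c r s t n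
  | Negz n => trib_down a b c r s t n.+3
  end.

Definition trib_u (F : fieldType) (r s t : F) (n : int) : F :=
  trib_w 0 1 r r s t n.

Lemma trib_w_rec (F : fieldType) (a b c r s t : F) (n : int) : t != 0 ->
  trib_w a b c r s t n =
    r * trib_w a b c r s t (n - 1) + s * trib_w a b c r s t (n - 2)
    + t * trib_w a b c r s t (n - 3).
Proof.
move=> t0.
have D (k : nat) : trib_down a b c r s t k =
    r * trib_down a b c r s t k.+1 + s * trib_down a b c r s t k.+2
    + t * trib_down a b c r s t k.+3.
  rewrite [trib_down _ _ _ _ _ _ k.+3]/= mulrCA divff // mulr1.
  rewrite -[_ - _ - _]addrA -opprD [RHS]addrC.
  by rewrite subrK.
case: n => [[|[|[|n]]]|n].
- exact: (D 2).
- exact: (D 1).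
- exact: (D 0).
- have -> : Posz n.+3 - 1 = n.+2 by [].
  have -> : Posz n.+3 - 2 = n.+1 by [].
  by have -> : Posz n.+3 - 3 = n by rewrite -[LHS]/(Posz (n - 0)) subn0.
- have -> : Negz n - 1 = Negz n.+1.
    by rewrite -[LHS]/(Negz (n + 0).+1) addn0.
  have -> : Negz n - 2 = Negz n.+2.
    by rewrite -[LHS]/(Negz (n + 1).+1) addn1.
  have -> : Negz n - 3 = Negz n.+3.
    by rewrite -[LHS]/(Negz (n + 2).+1) addn2.
  exact: (D n.+3).
Qed.

(* Main.v *)
(* With E the index shift, the addition formula reads E^m = u E + v + p E^-1,
   where u = u_m, v = u_(m+1) - r u_m and p = t u_(m-1); both of its sides satisfy
   the recurrence in m and agree at m = 0, 1, 2. Each identity isolates one of the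
   four terms, times a power of E, as a sum of three commuting monomials in E, and
   expands its k-th power by two nested binomial formulas. *)

Require Import Defs.
From HB Require Import structures.
From mathcomp Require Import all_boot all_order all_algebra.
From mathcomp Require Import reals.
From mathcomp Require Import complex.
From mathcomp Require Import ring.

Set Implicit Arguments.
Unset Strict Implicit.
Unset Printing Implicit Defensive.

Import Order.TTheory GRing.Theory Num.Theory.
Local Open Scope ring_scope.

(** * Nested binomial sums and the trinomial expansion *)

(** [g a b] stands for a monomial x^a y^b. Leaving [g] arbitrary allows nesting and lets [g] carry
    shifted sequence terms. *)
Definition binom_sum (V : nmodType) (k : nat) (g : nat -> nat -> V) : V :=
  \sum_(j < k.+1) g (k - j)%N j *+ 'C(k, j).

Lemma eq_binom_sum (V : nmodType) (k : nat) (g g' : nat -> nat -> V) :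
  (forall a b, g a b = g' a b) -> binom_sum k g = binom_sum k g'.
Proof. by move=> eq_g; apply: eq_bigr => j _; rewrite eq_g. Qed.

Lemma binom_sumD (V : nmodType) (k : nat) (g g' : nat -> nat -> V) :
  binom_sum k g + binom_sum k g' = binom_sum k (fun a b => g a b + g' a b).
Proof. by rewrite -big_split; apply: eq_bigr => j _ /=; rewrite mulrnDl. Qed.

(** Pascal's rule: one factor x + y is split off (x + y)^(k+1). *)
Lemma binom_sumS (V : nmodType) (k : nat) (g : nat -> nat -> V) :
  binom_sum k.+1 g = binom_sum k (fun a b => g a.+1 b + g a b.+1).
Proof.
rewrite -binom_sumD /binom_sum big_ord_recl /=.
under eq_bigr => j _ do rewrite /bump add1n binS subSS mulrnDr.
rewrite big_split /= addrA; congr (_ + _).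
(* In the sum with ['C(k, j.+1)] the last term vanishes, and the separated term j = 0 completes it
   at the front. *)
rewrite big_ord_recr /= (bin_small (ltnSn k)) mulr0n addr0 [RHS]big_ord_recl /=.
rewrite !subn0 !bin0; congr (_ + _); apply: eq_bigr => j _.
by rewrite /bump add1n -subSn.
Qed.

(** The model is h a b c = x^a y^b z^c with d = x + y + z. Splitting off one factor replaces [h] by
    the sum of its three shifts, which is d times [h] and satisfies the same relation. *)
Lemma trinom_sumE (R : comPzRingType) (k : nat) (d : R)
    (h : nat -> nat -> nat -> R) :
  (forall a b c, h a.+1 b c + h a b.+1 c + h a b c.+1 = d * h a b c) ->
  binom_sum k (fun a j => binom_sum j (h a)) = d ^+ k * h 0 0 0.
Proof.
elim: k h => [|k IHk] h hE.
  by rewrite /binom_sum !big_ord1 !bin0 !mulr1n mul1r.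
rewrite binom_sumS.
under eq_binom_sum => a j do rewrite binom_sumS binom_sumD.
rewrite (IHk (fun a b c => h a.+1 b c + (h a b.+1 c + h a b c.+1))).
  by rewrite addrA hE mulrA -exprSr.
by move=> a b c; rewrite !mulrDr -!hE; ring.
Qed.

(** The operator x E^al + y E^be + z E^ga acts on [f] as the scalar d, so its k-th power acts as
    d^k; [e] is a factor common to all terms. The summand [T] is matched through k = a + (b + c), j
    = b + c, i = c, so that truncated subtractions can be cancelled. *)
Lemma trinom_shift_sum (R : comPzRingType) (f : int -> R) (x y z d e : R)
    (al be ga n : int) (k : nat) (T : forall j : 'I_k.+1, 'I_j.+1 -> R) :
  (forall l, x * f (l + al) + y * f (l + be) + z * f (l + ga) = d * f l) ->
  (forall (j : 'I_k.+1) (i : 'I_j.+1) (a b c : nat),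
     k = (a + (b + c))%N -> j = (b + c)%N :> nat -> i = c :> nat ->
     T j i = 'C(k, j)%:R * 'C(j, i)%:R * (e * (x ^+ a * y ^+ b * z ^+ c))
             * f (n + al * a%:Z + be * b%:Z + ga * c%:Z)) ->
  \sum_(j < k.+1) \sum_(i < j.+1) T j i = e * d ^+ k * f n.
Proof.
move=> fE TE.
pose h a b c :=
  e * (x ^+ a * y ^+ b * z ^+ c) * f (n + al * a%:Z + be * b%:Z + ga * c%:Z).
transitivity (binom_sum k (fun a j => binom_sum j (h a))).
  apply: eq_bigr => j _; rewrite /binom_sum -sumrMnl; apply: eq_bigr => i _.
  have le_jk : (j <= k)%N by rewrite -ltnS.
  have le_ij : (i <= j)%N by rewrite -ltnS.
  rewrite (TE j i (k - j)%N (j - i)%N i) ?subnK //.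
  by rewrite -[RHS]mulr_natl -[h _ _ _ *+ _]mulr_natl !mulrA.
rewrite (@trinom_sumE _ k d h) => [|a b c].
  by rewrite /h !expr0 !mulr1 !mulr0 !addr0; ring.
rewrite /h [RHS]mulrCA -fE.
set l := n + al * a%:Z + be * b%:Z + ga * c%:Z.
have -> : n + al * a.+1%:Z + be * b%:Z + ga * c%:Z = l + al.
  by rewrite /l intS; ring.
have -> : n + al * a%:Z + be * b.+1%:Z + ga * c%:Z = l + be.
  by rewrite /l intS; ring.
have -> : n + al * a%:Z + be * b%:Z + ga * c.+1%:Z = l + ga.
  by rewrite /l intS; ring.
by rewrite !exprS; ring.
Qed.

(** * The six identities for any sequence with the addition formula *)

Section ShiftIdentities.

Variables (R : comPzRingType) (f : int -> R) (q v p : R) (m : int).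
Hypothesis f_add : forall n, f (n + m) = q * f (n + 1) + v * f n + p * f (n - 1).

(** With i = c and j = b + c, the sign (-1)^(i+j) is (-1)^b, the power of the middle coefficient
    -1. *)
Let signDD i j : (-1) ^+ (i + (j + i)) = (-1) ^+ j :> R.
Proof. by rewrite addnCA exprD addnn -mul2n exprM sqrrN !expr1n mulr1. Qed.

(** Uses p E^-1 + q E - E^m = -v, multiplied by q^k after expansion. *)
Lemma shift_sum1 (k : nat) (n : int) :
  \sum_(j < k.+1) \sum_(i < j.+1)
      (-1) ^+ i * 'C(k, j)%:R * 'C(j, i)%:R * p ^+ (k - j) * q ^+ (k + j - i)
      * f (n - k%:Z + 2 * j%:Z + (m - 1) * i%:Z)
    = v ^+ k * (- q) ^+ k * f n.
Proof.
rewrite (@trinom_shift_sum _ f p q (-1) (- v) (q ^+ k) (-1) 1 m n).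
- by rewrite [(- v) ^+ k]exprNn [(- q) ^+ k]exprNn; ring.
- by move=> l; rewrite f_add; ring.
move=> j i x y z kE jE iE; rewrite iE jE kE addnK -addnBA ?leq_addl // addnK.
rewrite (_ : n - _ + _ + _ = n + -1 * x%:Z + 1 * y%:Z + m * z%:Z).
  by rewrite exprD; ring.
by rewrite !PoszD; ring.
Qed.

(** The same relation with its first two terms exchanged, and common factor p^k. *)
Lemma shift_sum2 (k : nat) (n : int) :
  \sum_(j < k.+1) \sum_(i < j.+1)
      (-1) ^+ i * 'C(k, j)%:R * 'C(j, i)%:R * q ^+ (k - j) * p ^+ (k + j - i)
      * f (n + k%:Z - 2 * j%:Z + (m + 1) * i%:Z)
    = v ^+ k * (- p) ^+ k * f n.
Proof.
rewrite (@trinom_shift_sum _ f q p (-1) (- v) (p ^+ k) 1 (-1) m n).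
- by rewrite [(- v) ^+ k]exprNn [(- p) ^+ k]exprNn; ring.
- by move=> l; rewrite f_add; ring.
move=> j i x y z kE jE iE; rewrite iE jE kE addnK -addnBA ?leq_addl // addnK.
rewrite (_ : n + _ - _ + _ = n + 1 * x%:Z + -1 * y%:Z + m * z%:Z).
  by rewrite exprD; ring.
by rewrite !PoszD; ring.
Qed.

(** Uses E^m - p E^-1 - q E = v, with common factor p^k. *)
Lemma shift_sum3 (k : nat) (n : int) :
  \sum_(j < k.+1) \sum_(i < j.+1)
      (-1) ^+ j * 'C(k, j)%:R * 'C(j, i)%:R * p ^+ (k + j - i) * q ^+ i
      * f (n + m * k%:Z - (m + 1) * j%:Z + 2 * i%:Z)
    = v ^+ k * p ^+ k * f n.
Proof.
rewrite (@trinom_shift_sum _ f 1 (- p) (- q) v (p ^+ k) m (-1) 1 n).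
- by ring.
- by move=> l; rewrite f_add; ring.
move=> j i x y z kE jE iE; rewrite iE jE kE -addnBA ?leq_addl // addnK.
rewrite (_ : n + _ - _ + _ = n + m * x%:Z + -1 * y%:Z + 1 * z%:Z).
  by rewrite !exprD expr1n [(- p) ^+ y]exprNn [(- q) ^+ z]exprNn; ring.
by rewrite !PoszD; ring.
Qed.

(** Uses the formula divided by E^m: p E^-(m+1) + q E^(1-m) + v E^-m = 1. *)
Lemma shift_sum4 (k : nat) (n : int) :
  \sum_(j < k.+1) \sum_(i < j.+1)
      'C(k, j)%:R * 'C(j, i)%:R * p ^+ (k - j) * q ^+ (j - i) * v ^+ i
      * f (n - (m + 1) * k%:Z + 2 * j%:Z - i%:Z)
    = f n.
Proof.
rewrite (@trinom_shift_sum _ f p q v 1 1 (- (m + 1)) (1 - m) (- m) n).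
- by rewrite expr1n !mul1r.
- move=> l; have := f_add (l - m); rewrite subrK mul1r => ->.
  by rewrite opprD addrA [l + (1 - m)]addrCA [1 + (l - m)]addrC; ring.
move=> j i x y z kE jE iE; rewrite iE jE kE !addnK.
rewrite (_ : n - _ + _ - _ =
             n + - (m + 1) * x%:Z + (1 - m) * y%:Z + - m * z%:Z).
  by ring.
by rewrite !PoszD; ring.
Qed.

(** Uses p E^-2 - E^(m-1) + v E^-1 = -q. *)
Lemma shift_sum5 (k : nat) (n : int) :
  \sum_(j < k.+1) \sum_(i < j.+1)
      (-1) ^+ (i + j) * 'C(k, j)%:R * 'C(j, i)%:R * p ^+ (k - j) * v ^+ i
      * f (n - 2 * k%:Z + (m + 1) * j%:Z - m * i%:Z)
    = (-1) ^+ k * q ^+ k * f n.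
Proof.
rewrite (@trinom_shift_sum _ f p (-1) v (- q) 1 (- 2) (m - 1) (-1) n).
- by rewrite [(- q) ^+ k]exprNn mul1r.
- move=> l; have := f_add (l - 1).
  have -> : l - 1 - 1 = l - 2 by ring.
  by rewrite subrK addrAC -addrA => ->; ring.
move=> j i x y z kE jE iE; rewrite iE jE kE addnK signDD.
rewrite (_ : n - _ + _ - _ = n + - 2 * x%:Z + (m - 1) * y%:Z + -1 * z%:Z).
  by ring.
by rewrite !PoszD; ring.
Qed.

(** Uses q E^2 - E^(m+1) + v E = -p. *)
Lemma shift_sum6 (k : nat) (n : int) :
  \sum_(j < k.+1) \sum_(i < j.+1)
      (-1) ^+ (i + j) * 'C(k, j)%:R * 'C(j, i)%:R * q ^+ (k - j) * v ^+ i
      * f (n + 2 * k%:Z + (m - 1) * j%:Z - m * i%:Z)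
    = (-1) ^+ k * p ^+ k * f n.
Proof.
rewrite (@trinom_shift_sum _ f q (-1) v (- p) 1 2 (m + 1) 1 n).
- by rewrite [(- p) ^+ k]exprNn mul1r.
- move=> l; have := f_add (l + 1).
  have -> : l + 1 + 1 = l + 2 by ring.
  by rewrite addrK addrAC -addrA => ->; ring.
move=> j i x y z kE jE iE; rewrite iE jE kE addnK signDD.
rewrite (_ : n + _ + _ - _ = n + 2 * x%:Z + (m + 1) * y%:Z + 1 * z%:Z).
  by ring.
by rewrite !PoszD; ring.
Qed.

End ShiftIdentities.

(** * The addition formula for third-order sequences *)

Section Tribonacci.

Variables (F : fieldType) (a b c r s t : F).
Hypothesis t_neq0 : t != 0.

Let w := trib_w a b c r s t.
Let u := trib_u r s t.

Lemma trib_rec_eq0 (h : int -> F) :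
  (forall n, h n = r * h (n - 1) + s * h (n - 2) + t * h (n - 3)) ->
  h 0 = 0 -> h 1 = 0 -> h 2 = 0 -> forall n, h n = 0.
Proof.
move=> hE h0 h1 h2 n.
(* Three consecutive zeros form the induction invariant, carried in both directions from index 0. *)
suff [] : [/\ h n = 0, h (n + 1) = 0 & h (n + 2) = 0] by [].
elim: n => [|n [hn hn1 hn2]|n [hn hn1 hn2]]; first by rewrite !add0r.
- have -> : n.+1%:Z = n%:Z + 1 by rewrite intS addrC.
  have -> : n%:Z + 1 + 1 = n%:Z + 2 by ring.
  split=> //; rewrite hE.
  have -> : n%:Z + 1 + 2 - 1 = n%:Z + 2 by ring.
  have -> : n%:Z + 1 + 2 - 2 = n%:Z + 1 by ring.
  have -> : n%:Z + 1 + 2 - 3 = n%:Z by ring.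
  by rewrite hn hn1 hn2; ring.
- have -> : - n.+1%:Z = - n%:Z - 1 by rewrite intS; ring.
  have -> : - n%:Z - 1 + 1 = - n%:Z by ring.
  have e1 : - n%:Z - 1 + 2 = - n%:Z + 1 by ring.
  rewrite e1; split=> //.
  (* Downwards, the recurrence leaves 0 = t h(-n-1), and t is nonzero. *)
  have := hE (- n%:Z + 2).
  have -> : - n%:Z + 2 - 1 = - n%:Z + 1 by ring.
  have -> : - n%:Z + 2 - 2 = - n%:Z by ring.
  have -> : - n%:Z + 2 - 3 = - n%:Z - 1 by ring.
  rewrite hn hn1 hn2 !mulr0 !add0r => /esym/eqP.
  by rewrite mulf_eq0 (negPf t_neq0) => /eqP.
Qed.

Lemma trib_w_add (m n : int) :
  w (n + m) = u m * w (n + 1) + (u (m + 1) - r * u m) * w n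
              + t * u (m - 1) * w (n - 1).
Proof.
pose h m := w (n + m) - (u m * w (n + 1) + (u (m + 1) - r * u m) * w n
              + t * u (m - 1) * w (n - 1)).
apply/eqP; rewrite -subr_eq0 -/(h m); apply/eqP.
have uE k : u k = r * u (k - 1) + s * u (k - 2) + t * u (k - 3).
  exact: trib_w_rec.
have wE k : w k = r * w (k - 1) + s * w (k - 2) + t * w (k - 3).
  exact: trib_w_rec.
(* Needed at m = 0; it follows from the recurrence at index 2, which reads r = r + t u_(-1). *)
have tuN1 : t * u (-1) = 0.
  have := uE 2.
  rewrite -[2 - 1]/(1 : int) -[2 - 2]/(0 : int) -[2 - 3]/(-1 : int).
  rewrite -[u 2]/r -[u 1]/(1 : F) -[u 0]/(0 : F) mulr1 mulr0 addr0.
  by rewrite -{1}[r]addr0 => /addrI.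
have u3 : u 3 = r * r + s by rewrite /u /trib_u /= mulr1 mulr0 addr0.
apply: (trib_rec_eq0 (h := h)) m => [m|||]; rewrite /h.
- rewrite !addrA (wE (n + m)) {1}(uE (m - 1)) (uE (m + 1)) (uE m).
  rewrite ![m - _ + 1]addrAC [m - 2 - 1]addrAC [m - 3 - 1]addrAC; ring.
- rewrite addr0 !add0r tuN1 -[u 0]/(0 : F) -[u 1]/(1 : F); ring.
- rewrite subrr -[u (1 + 1)]/r -[u 0]/(0 : F) -[u 1]/(1 : F); ring.
(* At m = 2 the coefficient u_3 - r u_2 equals s, so the claim is the recurrence of [w] at n + 2. *)
- rewrite -[2 + 1]/(3 : int) -[2 - 1]/(1 : int) u3 -[u 2]/r -[u 1]/(1 : F).
  have e1 : n + 2 - 1 = n + 1 by ring.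
  have e2 : n + 2 - 2 = n by ring.
  have e3 : n + 2 - 3 = n - 1 by ring.
  by rewrite (wE (n + 2)) e1 e2 e3; ring.
Qed.

End Tribonacci.

Theorem theorem16 (R : realType) (a b c r s t : R[i]) (t_neq0 : t != 0)
    (k : nat) (k_gt0 : (0 < k)%N) (m n : int) :
  let w := trib_w a b c r s t in
  let u := trib_u r s t in
  (\sum_(j < k.+1) \sum_(i < j.+1)
      (-1) ^+ i * 'C(k, j)%:R * 'C(j, i)%:R
      * (t * u (m - 1)) ^+ (k - j) * u m ^+ (k + j - i)
      * w (n - k%:Z + 2 * j%:Z + (m - 1) * i%:Z)
    = (u (m + 1) - r * u m) ^+ k * (- u m) ^+ k * w n)
  /\
  (\sum_(j < k.+1) \sum_(i < j.+1)
      (-1) ^+ i * 'C(k, j)%:R * 'C(j, i)%:R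
      * u m ^+ (k - j) * (t * u (m - 1)) ^+ (k + j - i)
      * w (n + k%:Z - 2 * j%:Z + (m + 1) * i%:Z)
    = (u (m + 1) - r * u m) ^+ k * (- (t * u (m - 1))) ^+ k * w n)
  /\
  (\sum_(j < k.+1) \sum_(i < j.+1)
      (-1) ^+ j * 'C(k, j)%:R * 'C(j, i)%:R
      * (t * u (m - 1)) ^+ (k + j - i) * u m ^+ i
      * w (n + m * k%:Z - (m + 1) * j%:Z + 2 * i%:Z)
    = (u (m + 1) - r * u m) ^+ k * (t * u (m - 1)) ^+ k * w n)
  /\
  (\sum_(j < k.+1) \sum_(i < j.+1)
      'C(k, j)%:R * 'C(j, i)%:R
      * (t * u (m - 1)) ^+ (k - j) * u m ^+ (j - i)
      * (u (m + 1) - r * u m) ^+ i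
      * w (n - (m + 1) * k%:Z + 2 * j%:Z - i%:Z)
    = w n)
  /\
  (\sum_(j < k.+1) \sum_(i < j.+1)
      (-1) ^+ (i + j) * 'C(k, j)%:R * 'C(j, i)%:R
      * (t * u (m - 1)) ^+ (k - j) * (u (m + 1) - r * u m) ^+ i
      * w (n - 2 * k%:Z + (m + 1) * j%:Z - m * i%:Z)
    = (-1) ^+ k * u m ^+ k * w n)
  /\
  (\sum_(j < k.+1) \sum_(i < j.+1)
      (-1) ^+ (i + j) * 'C(k, j)%:R * 'C(j, i)%:R
      * u m ^+ (k - j) * (u (m + 1) - r * u m) ^+ i
      * w (n + 2 * k%:Z + (m - 1) * j%:Z - m * i%:Z)
    = (-1) ^+ k * (t * u (m - 1)) ^+ k * w n).
Proof.
move=> w u.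
(* For fixed m this is the hypothesis [f_add] with q = u_m, v = u_(m+1) - r u_m and p = t
   u_(m-1). *)
have wE l := trib_w_add a b c r s t_neq0 m l.
split; first exact: shift_sum1 wE k n.
split; first exact: shift_sum2 wE k n.
split; first exact: shift_sum3 wE k n.
split; first exact: shift_sum4 wE k n.
split; first exact: shift_sum5 wE k n.
exact: shift_sum6 wE k n.
Qed.
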